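(* There exist an Isbell-Mrówka $\Psi$-space $X$ (that is, $X=\Psi(\mathcal M)$ for some maximal almost disjoint family $\mathcal M$ of infinite subsets of $\mathbb N$) and a point $p\in\beta X\setminus X$ such that the subspace $X_p=X\cup\{p\}$ of $\beta X$ is a pseudocompact $\Delta$-space and $t(p,X_p)>\aleph_0$.
   Context: For an almost disjoint family $\mathcal A$ of infinite subsets of $\mathbb N$ (distinct members have finite intersection), the space $\Psi(\mathcal A)=\Psi(\mathbb N,\mathcal A)$ has underlying set $\mathbb N\cup\mathcal A$; points of $\mathbb N$ are isolated, and a base of neighborhoods of $A\in\mathcal A$ consists of all sets $\{A\}\cup B$ where $B\subseteq A$ and $A\setminus B$ is finite. When $\mathcal A$ is a maximal almost disjoint (MAD) family, $\Psi(\mathcal A)$ is called an Isbell-Mrówka space. $\beta X$ denotes the Stone-Čech compactification of $X$. A Tychonoff space $Y$ is pseudocompact if every continuous $f:Y\to\mathbb R$ is bounded. For a point $p$ of a space $Y$, $t(p,Y)=\aleph_0$ (countable tightness at $p$) means that whenever $p$ is in the closure of a set $Z\subseteq Y$, there is a countable $B\subseteq Z$ such that $p$ is in the closure of $B$; $t(p,Y)>\aleph_0$ means that this fails. A topological space $X$ is a $\Delta$-space if for every decreasing sequence $\{D_n:n\in\omega\}$ of subsets of $X$ with empty intersection there is a decreasing sequence $\{V_n:n\in\omega\}$ of open subsets of $X$, also with empty intersection, such that $D_n\subseteq V_n$ for every $n\in\omega$. *)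

(* Defs.v *)
From HB Require Import structures.
From mathcomp Require Import all_boot all_order all_algebra.
From mathcomp Require Import all_classical all_reals all_analysis.

Set Implicit Arguments.
Unset Strict Implicit.
Unset Printing Implicit Defensive.

Import Order.TTheory GRing.Theory Num.Theory.
Import numFieldNormedType.Exports.

Local Open Scope classical_set_scope.
Local Open Scope ring_scope.

Definition almost_disjoint (F : set (set nat)) : Prop :=
  (forall A, F A -> infinite_set A) /\
  (forall A B, F A -> F B -> A <> B -> finite_set (A `&` B)).

Definition maximal_almost_disjoint (F : set (set nat)) : Prop :=
  almost_disjoint F /\
  (forall G, almost_disjoint G -> F `<=` G -> G = F).

(* The disjoint union of nat and F, under a new name so that it carries the
   topology defined below. *)
Definition Psi (F : set (set nat)) : Type := (nat + set_type F)%type.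

Section PsiTopology.
Variable F : set (set nat).

HB.instance Definition _ := Choice.copy (Psi F) (nat + set_type F)%type.

Definition Psi_nbhs (x : Psi F) : set_system (Psi F) :=
  match x with
  | inl n => [set U | U (inl n)]
  | inr A => [set U | exists B : set nat,
      [/\ B `<=` val A, finite_set (val A `\` B) &
          [set inr A] `|` [set inl n | n in B] `<=` U]]
  end.

Lemma Psi_nbhs_filter (x : Psi F) : ProperFilter (Psi_nbhs x).
Proof.
case: x => [n|A]; (split; last split) => //=.
- by move=> U V UV /UV.
- by move=> [B [_ _ /(_ (inr A))]]; apply; left.
- by exists (val A); split=> //; rewrite setDv.
- move=> U V [B [BA fB BU]] [C [CA fC CV]]; exists (B `&` C); split.
  + by move=> n [/BA].
  + by rewrite setDIr finite_setU.
  + move=> z [->|[n [Bn Cn] <-]]; split.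
    * by apply: BU; left.
    * by apply: CV; left.
    * by apply: BU; right; exists n.
    * by apply: CV; right; exists n.
- by move=> U V UV [B [BA fB BU]]; exists B; split=> // z /BU /UV.
Qed.

Lemma Psi_nbhs_singleton (x : Psi F) (U : set (Psi F)) : Psi_nbhs x U -> U x.
Proof. by case: x => [n //|A] [B [_ _]]; apply; left. Qed.

Lemma Psi_nbhs_nbhs (x : Psi F) (U : set (Psi F)) :
  Psi_nbhs x U -> Psi_nbhs x (Psi_nbhs^~ U).
Proof.
case: x => [n //|A] [B [BA fB BU]]; exists B; split=> // z.
case=> [->|[n Bn <-]]; first by exists B.
by apply: BU; right; exists n.
Qed.

HB.instance Definition _ := hasNbhs.Build (Psi F) Psi_nbhs.
HB.instance Definition _ := Nbhs_isNbhsTopological.Build (Psi F)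
  Psi_nbhs_filter Psi_nbhs_singleton Psi_nbhs_nbhs.

End PsiTopology.

(* The Stone-Cech compactification of a (Tychonoff) space X, as the closure of
   the image of X under the evaluation map into the cube [0,1]^C(X,[0,1]). *)
Section StoneCech.
Variables (R : realType) (X : topologicalType).

Definition unit_interval : topologicalType := set_type `[0 : R, 1]%classic.

Definition cube : topologicalType :=
  prod_topology (fun _ : continuousType X unit_interval => unit_interval).

Definition cube_eval (x : X) : cube := fun f => f x.

Definition stone_cech : topologicalType :=
  set_type (closure (range cube_eval)).

Definition stone_cech_embed (x : X) : stone_cech :=
  SigSub (mem_set (subset_closure (imageT cube_eval x))).

(* The subspace X + {p} of the compactification. *)
Definition adjoin_set (p : stone_cech) : set stone_cech :=
  range stone_cech_embed `|` [set p].

Definition adjoin (p : stone_cech) : topologicalType :=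
  set_type (adjoin_set p).

Definition adjoined_point (p : stone_cech) : adjoin p :=
  SigSub (mem_set (or_intror (erefl p) : adjoin_set p p)).

End StoneCech.

Definition tychonoff_space (Y : topologicalType) : Prop :=
  accessible_space Y /\ completely_regular_space Y.

Definition pseudocompact (R : realType) (Y : topologicalType) : Prop :=
  tychonoff_space Y /\ (forall f : Y -> R, continuous f -> bounded_fun f).

Definition countably_tight_at (Y : topologicalType) (p : Y) : Prop :=
  forall Z : set Y, closure Z p ->
    exists B : set Y, [/\ countable B, B `<=` Z & closure B p].

Definition Delta_space (X : topologicalType) : Prop :=
  forall D : nat -> set X,
    nonincreasing_seq D -> \bigcap_n D n = set0 ->
    exists V : nat -> set X,
      [/\ forall n, open (V n), nonincreasing_seq V, \bigcap_n V n = set0 &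
          forall n, D n `<=` V n].

(* Main.v *)
From HB Require Import structures.
Require Import Defs.
From mathcomp Require Import all_boot all_order all_algebra.
From mathcomp Require Import all_classical all_reals all_analysis.
From mathcomp Require Import zify.

(** Write [A <=* B] for [almost_sub A B], inclusion up to a finite set.  The
    point of uncountable tightness is the limit of a tower: a family [C] of
    subsets of the integers, well ordered by [<=*] (up to finite changes), in
    which every countable subfamily is strictly below some member.

    Such a tower comes from Zorn's lemma applied to the well ordered families
    of coinfinite sets, ordered by end extension.  If a countable subfamily of
    a maximal one had no strict bound in it, that subfamily would be cofinal,
    and diagonalization ([almost_chain_strict_bound]) would produce a
    coinfinite set strictly above everything, to be added on top.

    Next, choose the maximal almost disjoint family [M] so that each member
    [A] is decided by the tower: for every [T] in [C], either [A <=* T] or [A]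
    and [T] are almost disjoint.  Well ordering gives enough decided sets: an
    infinite [B] either is almost disjoint from every member of [C], or may be
    cut down to its trace on the least member that it meets in an infinite
    set ([tower_decided_subset]).  Decidedness says precisely that for [T] in
    [C] the set [Psi_under T], consisting of [T] and of the members of [M]
    almost included in [T], is clopen in [Psi M].

    Let [ladder T] be the set of members of [M] almost included in some member
    of [C] but not in [T].  These sets are nonempty and decrease along the
    tower, so by compactness some [p] in the Stone-Cech compactification lies
    in the closure of all of them.  It is not in [Psi M], and it lies in the
    closure of the set [Z] of all members of [M] almost included in some
    member of [C].  But a countable subset of [Z] is contained in
    [Psi_under T] for a single [T] in [C]; the closure of this clopen set is
    disjoint from that of [ladder T], so it misses [p].  Hence the tightness
    at [p] is uncountable ([ladder_point_not_tight]).

    The two other properties hold for every new point [p].  Pseudocompactness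
    passes from [Psi M] to any space in which it is dense, and a continuous
    real function on [Psi M] is bounded because it is bounded on the integers:
    otherwise it would tend to infinity on an infinite set of integers, which
    meets some member of [M] in an infinite set ([Psi_mad_bounded]).  For the
    Delta property, let [D n] decrease to the empty set; once [p] has left
    [D n], enlarge each point of [D n] to its [n]-th basic neighbourhood
    ([adjoin_Psi_Delta]). *)

Set Implicit Arguments.
Unset Strict Implicit.
Unset Printing Implicit Defensive.

Import Order.TTheory GRing.Theory Num.Theory.
Import numFieldNormedType.Exports.

Local Open Scope classical_set_scope.

(** * Almost inclusion and diagonalization *)

Definition almost_sub (A B : set nat) : Prop := finite_set (A `\` B).

Lemma sub_almost_sub (A B : set nat) : A `<=` B -> almost_sub A B.
Proof. by rewrite -setD_eq0 /almost_sub => ->. Qed.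

Lemma almost_sub_refl (A : set nat) : almost_sub A A.
Proof. exact: sub_almost_sub. Qed.

Lemma almost_sub_trans (B A C : set nat) :
  almost_sub A B -> almost_sub B C -> almost_sub A C.
Proof.
move=> AB BC; apply: (@sub_finite_set _ _ ((A `\` B) `|` (B `\` C))).
  by move=> n [An Cn]; have [Bn|Bn] := pselect (B n); [right|left].
by rewrite finite_setU.
Qed.

Lemma infinite_set_unbounded (A : set nat) (m : nat) :
  infinite_set A -> exists2 n, m < n & A n.
Proof.
move=> Ainf; apply: contrapT => noA; apply: Ainf.
apply: sub_finite_set (finite_II m.+1) => n An /=.
by rewrite ltnS leqNgt; apply/negP => mn; apply: noA; exists n.
Qed.

(** In an almost-chain a finite union is almost equal to its largest member,
    hence still coinfinite. *)
Lemma almost_chain_unionN (s : nat -> set nat) (n : nat) :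
  (forall i, infinite_set (~` s i)) ->
  (forall i j, almost_sub (s i) (s j) \/ almost_sub (s j) (s i)) ->
  infinite_set (~` [set x | exists2 i, i <= n & s i x]).
Proof.
move=> s_co s_chain; set F := fun n => [set x | exists2 i, i <= n & s i x].
suff [k Fk] : exists k, almost_sub (F n) (s k).
  move=> finF; apply: (s_co k).
  apply: (@sub_finite_set _ _ (~` F n `|` (F n `\` s k))).
    by move=> x skx; have [Fx|Fx] := pselect (F n x); [right|left].
  by rewrite finite_setU.
elim: n => [|n [k Fk]].
  by exists 0; apply: sub_almost_sub => x [i]; rewrite leqn0 => /eqP ->.
have FS : F n.+1 `<=` F n `|` s n.+1.
  move=> x [i]; rewrite leq_eqVlt ltnS => /orP[/eqP ->|lein] six; first by right.
  by left; exists i.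
have [km|mk] := s_chain k n.+1; [exists n.+1|exists k];
    apply: almost_sub_trans (sub_almost_sub FS) _;
    rewrite /almost_sub setDUl finite_setU; split => //.
- exact: almost_sub_trans Fk km.
- exact: almost_sub_refl.
Qed.

(** The limit step of towers.  Pick an increasing sequence [x] such that [x n]
    avoids the first [n.+1] sets of the chain.  The set [U] of integers other
    than the [x n.*2] then works: each set of the chain contains only finitely
    many of the removed points, and omits all but finitely many of the points
    [x n.*2.+1], which belong to [U]. *)
Lemma almost_chain_strict_bound (s : nat -> set nat) :
  (forall i, infinite_set (~` s i)) ->
  (forall i j, almost_sub (s i) (s j) \/ almost_sub (s j) (s i)) ->
  exists U, infinite_set (~` U) /\
    forall i, almost_sub (s i) U /\ ~ almost_sub U (s i).
Proof.
move=> s_co s_chain; pose F n := [set x | exists2 i, i <= n & s i x].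
have next n m : {x | m < x /\ ~ F n x}.
  apply: cid; have [x mx Fx] :=
    infinite_set_unbounded m (almost_chain_unionN (n := n) s_co s_chain).
  by exists x.
pose x := fix x n := if n is n'.+1 then sval (next n (x n')) else sval (next 0 0).
have xF n : ~ F n (x n) by case: n => [|n] /=; case: (next _ _) => y [].
have xS n : x n < x n.+1 by rewrite /=; case: (next _ _) => y [].
have x_mono m n : m < n -> x m < x n.
  elim: n => // n IH; rewrite ltnS leq_eqVlt => /orP[/eqP->//|/IH].
  by move=> /ltn_trans; apply.
have x_inj : injective x.
  move=> m n xmn; apply/eqP; rewrite eqn_leq.
  by case: ltngtP => // /x_mono; rewrite xmn ltnn.
have s_x i n : s i (x n) -> n < i.
  by move=> sixn; rewrite ltnNge; apply/negP => lein; apply: (xF n); exists i.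
have inf_sub (f : nat -> nat) (A : set nat) :
    injective f -> (forall n, A (x (f n))) -> infinite_set A.
  move=> f_inj fA Afin; apply: infinite_nat.
  rewrite (_ : setT = (x \o f) @^-1` A).
    by apply: finite_preimage => // m n _ _ /x_inj/f_inj.
  by apply/seteqP; split=> n _ //=; exact: fA.
exists (~` [set x n.*2 | n in setT]); split.
  rewrite setCK; apply: (inf_sub double); first exact: double_inj.
  by move=> n; exists n.
move=> i; split.
  apply: (@sub_finite_set _ _ (x @` `I_i)); last exact: finite_image.
  by move=> m [sim /contrapT[n _ nm]]; exists n.*2 => //=; apply: s_x; rewrite nm.
apply: (inf_sub (fun n => (i + n).*2.+1)).
  by move=> m n /succn_inj/double_inj/addnI.
move=> n; split; last by move/s_x; rewrite ltnNge; lia.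
by case=> m _ /x_inj; lia.
Qed.


(** * Towers *)

(** Leastness is asked of some member only, not of a unique one, so that no
    quotient by almost equality has to be formed. *)
Record almost_tower (C : set (set nat)) : Prop := AlmostTower {
  tower_least : forall S, S `<=` C -> S !=set0 ->
    exists2 A, S A & forall B, S B -> almost_sub A B;
  tower_coinfinite : forall A, C A -> infinite_set (~` A) }.

Definition end_extension (C C' : set (set nat)) : Prop :=
  C `<=` C' /\ forall A B, C A -> C' B -> ~ C B ->
    almost_sub A B /\ ~ almost_sub B A.

Lemma tower_total (C : set (set nat)) (A B : set nat) :
  almost_tower C -> C A -> C B -> almost_sub A B \/ almost_sub B A.
Proof.
move=> [least _] CA CB; have [||D [->|->] AD] := least [set A; B].
- by move=> _ [->|->].
- by exists A; left.
- by left; apply: AD; right.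
- by right; apply: AD; left.
Qed.

Lemma end_extension_trans (C D E : set (set nat)) :
  end_extension C D -> end_extension D E -> end_extension C E.
Proof.
move=> [CD CDlt] [DE DElt]; split; first exact: subset_trans DE.
move=> A B CA EB nCB; have [DB|nDB] := pselect (D B); first exact: CDlt.
by apply: DElt => //; exact: CD.
Qed.

(** Well ordering survives unions of chains only because the order is end
    extension: the least element of a subfamily of the union may be computed
    within any stage that the subfamily meets. *)
Lemma exists_maximal_tower : exists2 C, almost_tower C &
  forall D, almost_tower D -> end_extension C D -> D `<=` C.
Proof.
pose T := {C | almost_tower C}.
pose R (C D : T) := `[< end_extension (sval C) (sval D) >].
have tower0 : almost_tower set0.
  by split=> // S S0 [A SA]; have := S0 _ SA.
have [|C D E /asboolP CD /asboolP DE|F Ftot|[C Ct] Cmax] :=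
    @ZL_preorder T (exist _ _ tower0) R.
- by move=> C; apply/asboolP; split.
- by apply/asboolP; exact: end_extension_trans DE.
- pose U := [set A | exists2 C, F C & sval C A].
  have UF C A B : F C -> sval C A -> U B -> ~ sval C B ->
      almost_sub A B /\ ~ almost_sub B A.
    move=> FC CA [D FD DB] nCB; have [/asboolP[_]|/asboolP[DC]] := Ftot _ _ FC FD.
      exact.
    by move: (DC _ DB).
  have Ut : almost_tower U.
    split=> [S SU [A SA]|A [C _]]; last by case: C => C [_ Cco] /=; exact: Cco.
    have [C FC CA] := SU _ SA; have [Cleast _] := svalP C.
    have [||B [SB CB] Bmin] := Cleast (S `&` sval C).
    - by move=> ? [].
    - by exists A.
    exists B => // D SD; have [CD|nCD] := pselect (sval C D); first exact: Bmin.
    by have [] := UF C B D FC CB (SU _ SD) nCD.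
  exists (exist _ U Ut) => C FC; apply/asboolP; split=> [A CA|A B].
    by exists C.
  exact: UF.
exists C => // D Dt CD; have /asboolP[] // : R (exist _ D Dt) (exist _ C Ct).
by apply: Cmax; apply/asboolP.
Qed.

(** For a tower this is uncountable cofinality, with no largest element. *)
Definition strict_directed (C : set (set nat)) : Prop :=
  forall D, countable D -> D `<=` C -> exists2 T, C T &
    forall A, D A -> almost_sub A T /\ ~ almost_sub T A.

(** A countable subfamily without a strict bound is cofinal, because a tower
    is totally ordered; then a strict almost-upper bound of that subfamily is
    one of the whole tower, and adding it contradicts maximality. *)
Lemma maximal_tower_directed (C : set (set nat)) :
  almost_tower C ->
  (forall D, almost_tower D -> end_extension C D -> D `<=` C) ->
  strict_directed C.
Proof.
move=> Ct Cmax D Dcount DC; apply: contrapT => noT.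
have cofinal T : C T -> exists2 A, D A & almost_sub T A.
  move=> CT; apply: contrapT => noA; apply: noT; exists T => // A DA.
  have nTA : ~ almost_sub T A by move=> TA; apply: noA; exists A.
  by split=> //; have [] := tower_total Ct CT (DC _ DA).
(* The countable subfamily may be empty or finite: pad with the empty set. *)
have [s sP] : exists s : nat -> set nat,
    (forall n, D (s n) \/ s n = set0) /\ forall A, D A -> exists n, s n = A.
  have [f finj] := countable_injP _ Dcount.
  pose P n A := D A /\ f A = n.
  exists (fun n => xget set0 (P n)); split=> [n|A DA].
    by case: xgetP => [A _ [DA _]|]; [left|right].
  exists (f A); case: xgetP => [B _ [DB]|/(_ A)[]//].
  by apply: finj; rewrite inE.
have [sD sE] := sP.
have s_sub n m : almost_sub (s n) (s m) \/ almost_sub (s m) (s n).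
  have [Dn|->] := sD n; last by left; apply: sub_almost_sub.
  have [Dm|->] := sD m; last by right; apply: sub_almost_sub.
  exact: tower_total Ct (DC _ Dn) (DC _ Dm).
have s_co n : infinite_set (~` s n).
  have [Dn|->] := sD n; first exact: tower_coinfinite Ct _ (DC _ Dn).
  by rewrite setC0; exact: infinite_nat.
have [U [Uco sU]] := almost_chain_strict_bound s_co s_sub.
have CU T : C T -> almost_sub T U /\ ~ almost_sub U T.
  move=> CT; have [A DA TA] := cofinal T CT; have [n snA] := sE A DA.
  have [] := sU n; rewrite snA => AU UA; split; first exact: almost_sub_trans AU.
  by move=> UT; apply: UA; exact: almost_sub_trans TA.
have nCU : ~ C U by move=> /CU[_]; apply; exact: almost_sub_refl.
apply: nCU; apply: (Cmax (C `|` [set U])); last by right.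
- split=> [S SCU [A SA]|A [CA|->//]]; last exact: tower_coinfinite CA.
  have [[B [SB CB]]|noC] := pselect ((S `&` C) !=set0).
    have [||E [SE CE] Emin] := tower_least Ct (S := S `&` C).
    - by move=> ? [].
    - by exists B.
    exists E => // F SF; have [CF|->] := SCU _ SF; first exact: Emin.
    by have [] := CU _ CE.
  have SU B : S B -> B = U.
    by move=> SB; have [CB|//] := SCU _ SB; case: noC; exists B.
  by exists A => // B SB; rewrite (SU _ SB) (SU _ SA); exact: almost_sub_refl.
- split=> [A CA|A B CA [//|->] _]; first by left.
  exact: CU.
Qed.


(** * Maximal almost disjoint families decided by a tower *)

Definition decides (C : set (set nat)) (A : set nat) : Prop :=
  forall T, C T -> almost_sub A T \/ finite_set (A `&` T).

(** If [B] meets some member of the tower in an infinite set, cut it down to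
    the least such member [S]: members meeting [B] in an infinite set almost
    include [S], and the others are almost disjoint from [B]. *)
Lemma tower_decided_subset (C : set (set nat)) (B : set nat) :
  almost_tower C -> infinite_set B ->
  exists A, [/\ A `<=` B, infinite_set A & decides C A].
Proof.
move=> Ct Binf.
pose Inf := [set T | C T /\ infinite_set (B `&` T)].
have [[T [CT BT]]|noT] := pselect (Inf !=set0); last first.
  exists B; split=> // T CT; right; apply: contrapT => BT.
  by apply: noT; exists T.
have [||S [CS BS] Smin] := tower_least Ct (S := Inf).
- by move=> ? [].
- by exists T.
exists (B `&` S); split=> // U CU.
have [BU|BU] := pselect (finite_set (B `&` U)).
  by right; apply: sub_finite_set BU => n [[]].
by left; apply: sub_finite_set (Smin U (conj CU BU)) => n [[]].
Qed.

Lemma mad_meets (M : set (set nat)) (B : set nat) :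
  maximal_almost_disjoint M -> infinite_set B ->
  exists2 A, M A & infinite_set (A `&` B).
Proof.
move=> [[Minf Mad] Mmax] Binf; apply: contrapT => noA.
have BM A : M A -> finite_set (A `&` B).
  by move=> MA; apply: contrapT => AB; apply: noA; exists A.
have MB : M B.
  rewrite -(Mmax (M `|` [set B])); first by right.
  - split=> [A [|->//]|A A' [MA|->] [MA'|->] //]; first exact: Minf.
    + exact: Mad.
    + by move=> _; exact: BM.
    + by move=> _; rewrite setIC; exact: BM.
  - by move=> A; left.
by have := BM B MB; rewrite setIid.
Qed.

(** A family maximal among the almost disjoint families contained in [Q] is
    maximal among all of them: a new set [B] would contain a set of [Q],
    almost disjoint from the family too. *)
Lemma exists_mad_in (Q : set (set nat)) :
  (forall B, infinite_set B ->
    exists A, [/\ A `<=` B, infinite_set A & Q A]) ->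
  exists2 M, maximal_almost_disjoint M & M `<=` Q.
Proof.
move=> Qdense.
have [F FP Ftot|M [[Mad MQ] Mmax]] :=
    @Zorn_bigcup _ [set F | almost_disjoint F /\ F `<=` Q].
  split=> [|A [G FG GA]]; last by have [_] := FP _ FG; apply.
  split=> [A [G FG GA]|A B [G FG GA] [H FH HB]].
    by have [[Ginf _] _] := FP _ FG; exact: Ginf.
  have [GH|HG] := Ftot _ _ FG FH.
    by have [[_ Had] _] := FP _ FH; apply: Had => //; exact: GH.
  by have [[_ Gad] _] := FP _ FG; apply: Gad => //; exact: HG.
exists M => //; split=> // G [Ginf Gad] MG; apply/seteqP; split=> // B GB.
apply: contrapT => nMB.
have [A [AB Ainf QA]] := Qdense B (Ginf B GB).
have AM A' : M A' -> finite_set (A' `&` A).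
  move=> MA'; apply: (@sub_finite_set _ _ (A' `&` B)); first exact: setIS.
  by apply: Gad => //; [exact: MG|move=> A'B; apply: nMB; rewrite -A'B].
apply: (Mmax (M `|` [set A])).
  split; first by move=> A' ?; left.
  by move=> /(_ A (or_intror erefl)) /AM; rewrite setIid.
split=> [|A' [/MQ//|->//]]; split=> [A' [MA'|->//]|A1 A2 [M1|->] [M2|->] //].
- exact: Mad.1.
- exact: Mad.2.
- by move=> _; exact: AM.
- by move=> _; rewrite setIC; exact: AM.
Qed.

Local Open Scope ring_scope.

(** * The topology of Psi-spaces *)

Section PsiFacts.
Variable F : set (set nat).

Lemma Psi_openP (W : set (Psi F)) :
  open W <-> forall A : set_type F, W (inr A) ->
    almost_sub (val A) [set n | W (inl n)].
Proof.
rewrite openE; split=> [Wopen A WA|Wopen [n Wn //|A WA]].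
  have [B [BA Bfin BW]] := Wopen _ WA.
  apply: sub_finite_set Bfin => n [An nWn]; split=> // Bn.
  by apply: nWn; apply: BW; right; exists n.
exists (val A `&` [set n | W (inl n)]); split=> [n []//||x [->//|[n [_ Wn] <-//]]].
by apply: sub_finite_set (Wopen A WA) => n [An AW]; split=> // Wn; apply: AW.
Qed.

Lemma Psi_clopenP (W : set (Psi F)) :
  (forall A : set_type F, W (inr A) -> almost_sub (val A) [set n | W (inl n)]) ->
  (forall A : set_type F, ~ W (inr A) ->
    finite_set (val A `&` [set n | W (inl n)])) ->
  clopen W.
Proof.
move=> Win Wout; split; first exact/Psi_openP.
rewrite -openC; apply/Psi_openP => A nWA.
by apply: sub_finite_set (Wout A nWA) => n [An /contrapT].
Qed.

Definition Psi_basic (n : nat) (x : Psi F) : set (Psi F) :=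
  match x with
  | inl k => [set inl k]
  | inr A => [set inr A] `|` [set inl m | m in [set m | val A m /\ (n <= m)%N]]
  end.

Lemma Psi_basic_clopen (n : nat) (x : Psi F) :
  almost_disjoint F -> clopen (Psi_basic n x).
Proof.
move=> [_ Fad]; case: x => [k|A]; apply: Psi_clopenP => B //=.
- by move=> _; apply: sub_finite_set (finite_set1 k) => m /= [_ [->]].
- case=> [[->]|[m _ //]]; apply: sub_finite_set (finite_II n) => m [Am nm] /=.
  by rewrite ltnNge; apply/negP => nlem; apply: nm; right; exists m.
- move=> nBA; have BA : val B <> val A.
    by move=> /val_inj BA; apply: nBA; left; rewrite BA.
  apply: sub_finite_set (Fad _ _ (set_valP B) (set_valP A) BA) => m [Bm].
  by move=> [//|[m' [Am' _] [mE]]]; rewrite -mE; split=> //; rewrite mE.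
Qed.

Lemma Psi_basic_inr (n : nat) (x : Psi F) (A : set_type F) :
  Psi_basic n x (inr A) -> x = inr A.
Proof. by case: x => [k //|B] /= [->|[]]. Qed.

(** The closure of [T] in the Psi-space when [T] is almost included in, or
    almost disjoint from, every member of the family: the clopen set that
    [T] determines. *)
Definition Psi_under (T : set nat) : set (Psi F) :=
  [set x | match x with inl n => T n | inr A => almost_sub (val A) T end].

Lemma Psi_under_clopen (T : set nat) :
  (forall A, F A -> almost_sub A T \/ finite_set (A `&` T)) ->
  clopen (Psi_under T).
Proof.
move=> FT; apply: Psi_clopenP => // A /= nAT.
by have [//|] := FT _ (set_valP A).
Qed.

Lemma Psi_nat_dense : (forall A, F A -> infinite_set A) ->
  closure (range (inl : nat -> Psi F)) = setT.
Proof.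
move=> Finf; apply/seteqP; split=> // -[n|A] _ U.
  by move=> Un; exists (inl n); split=> //; exact: nbhs_singleton Un.
move=> [B [BA Bfin BU]].
have [n Bn] : B !=set0.
  apply/set0P/eqP => B0; apply: (Finf _ (set_valP A)).
  by move: Bfin; rewrite B0 setD0.
by exists (inl n); split; [exists n|apply: BU; right; exists n].
Qed.

(** If [f] were unbounded on the integers, pick [b k] with [k < `|f (b k)|]; a
    member [A] of the family meets the range of [b] in an infinite set, along
    which [f] is unbounded although it is continuous at [A]. *)
Lemma Psi_mad_bounded (R : realType) (f : Psi F -> R) :
  maximal_almost_disjoint F -> continuous f ->
  exists K, forall n, `|f (inl n)| <= K.
Proof.
move=> Fmad fc; apply: contrapT => unb.
have big (k : nat) : {n | k%:R < `|f (inl n)|}.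
  apply: cid; apply: contrapT => nok; apply: unb; exists k%:R => n.
  by rewrite leNgt; apply/negP => kn; apply: nok; exists n.
pose b k := sval (big k).
have bP k : k%:R < `|f (inl (b k))| by exact: (svalP (big k)).
have fin_below (L : R) : finite_set [set n | range b n /\ `|f (inl n)| <= L].
  apply: (@sub_finite_set _ _ (b @` `I_(Num.bound L))); last exact: finite_image.
  move=> _ [[k _ <-] fL]; exists k => //=.
  rewrite -(ltr_nat R); apply: lt_le_trans (bP k) (le_trans fL _).
  by apply/ltW/archi_boundP; exact: le_trans (normr_ge0 _) fL.
have binf : infinite_set (range b).
  move=> /finite_seqP[s bs]; pose L := \sum_(n <- s) `|f (inl n)|.
  have bL k : `|f (inl (b k))| <= L.
    have bks : b k \in s by have : range b (b k) by [exists k]; rewrite bs.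
    by rewrite /L (big_rem _ bks) /= lerDl sumr_ge0.
  apply: infinite_nat; apply: sub_finite_set (finite_II (Num.bound L)) => k _ /=.
  rewrite -(ltr_nat R); apply: lt_le_trans (bP k) (le_trans (bL k) _).
  by apply/ltW/archi_boundP; rewrite /L sumr_ge0.
have [A FA Ab] := mad_meets Fmad binf.
pose A' : set_type F := SigSub (mem_set FA).
have : nbhs (inr A' : Psi F) [set x : Psi F | `|f x| <= `|f (inr A')| + 1].
  have near1 := fc (inr A') _ (nbhsx_ballx (f (inr A')) 1%R ltr01).
  apply: (@filterS _ _ (Psi_nbhs_filter (inr A')) _ _ _ near1) => x.
  rewrite /= -ball_normE /= => fAx.
  by rewrite -lerBlDl ltW//; apply: le_lt_trans (lerB_dist _ _) _; rewrite distrC.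
move=> [B [BA Bfin BU]]; apply: Ab.
apply: (@sub_finite_set _ _ ((A `\` B) `|`
    [set n | range b n /\ `|f (inl n)| <= `|f (inr A')| + 1])).
  move=> n [An bn]; have [Bn|nBn] := pselect (B n); [right|left] => //.
  by split=> //; apply: BU; right; exists n.
by rewrite finite_setU; split=> //; exact: fin_below.
Qed.

End PsiFacts.

(** * Subspaces and the Stone-Cech compactification *)

Lemma set_val_inj (T : Type) (A : set T) : injective (set_val : A -> T).
Proof. by move=> x y; rewrite set_valE; exact: val_inj. Qed.

Lemma compact_set_type (X : topologicalType) (A : set X) :
  compact A -> compact [set: set_type A].
Proof.
move=> Aco F FF _; pose G := (set_val : A -> X) @ F.
have GA : G A by apply: (@filterE _ F) => x; exact: set_valP.
have [x [Ax xG]] := Aco G _ GA.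
exists (SigSub (mem_set Ax)); split=> // U V FU [_ [[W Wopen <-] Wx WV]].
have GU : G (set_val @` U) by apply: (@filterS _ F _ U) FU => u Uu; exists u.
have [_ [[u Uu <-] Wu]] := xG _ _ GU (open_nbhs_nbhs (conj Wopen Wx)).
by exists u; split=> //; exact: WV.
Qed.

Lemma accessible_set_type (X : topologicalType) (A : set X) :
  accessible_space X -> accessible_space (set_type A).
Proof.
move=> Xacc x y xy; have [|U [Uopen xU yU]] := Xacc (set_val x) (set_val y).
  by apply: contra_neq xy => /set_val_inj.
exists (set_val @^-1` U); split; [by exists U| |].
- by rewrite inE; exact: set_mem xU.
- by rewrite inE; exact: set_mem yU.
Qed.

(** A closed set of the subspace is the trace of a closed set of [X], and the
    restriction of a function separating the latter from a point still does. *)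
Lemma completely_regular_set_type (R : realType) (X : topologicalType)
    (A : set X) :
  completely_regular_space X -> completely_regular_space (set_type A).
Proof.
move=> Xcr x B; rewrite -openC => -[U Uopen UB] nBx.
have Ux : U (set_val x) by have : (~` B) x by []; rewrite -UB.
have [|f [fcont f01 fx fU]] := (@uniform_separatorP _ R _ _).1
    (Xcr (set_val x) (~` U) (open_closedC Uopen) _); first by move/(_ Ux).
apply/(@uniform_separatorP _ R); exists (f \o set_val); split.
- move=> z; apply: continuous_comp; last exact: fcont.
  exact: initial_continuous.
- by move=> _ [z _ <-]; apply: f01; exists (set_val z).
- by move=> _ [z -> <-]; apply: fx; exists (set_val x).
- move=> _ [z Bz <-]; apply: fU; exists (set_val z) => // Uz.
  by have : (~` B) z by rewrite -UB.
Qed.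

Lemma tychonoff_set_type (R : realType) (X : topologicalType) (A : set X) :
  tychonoff_space X -> tychonoff_space (set_type A).
Proof.
move=> [Xacc Xcr]; split; first exact: accessible_set_type.
exact: (completely_regular_set_type R).
Qed.

Lemma dense_sub_closed (X : topologicalType) (A C : set X) :
  closure A = setT -> closed C -> A `<=` C -> forall x, C x.
Proof. by move=> AT Cclosed sAC x; apply/Cclosed/(closureS sAC); rewrite AT. Qed.

Section StoneCechFacts.
Variables (R : realType) (X : topologicalType).

Lemma unit_interval_compact : compact [set: unit_interval R].
Proof. exact/compact_set_type/segment_compact. Qed.

Lemma unit_interval_tychonoff : tychonoff_space (unit_interval R).
Proof.
apply: (tychonoff_set_type R); split.
  exact/hausdorff_accessible/Rhausdorff.
exact: (@uniform_completely_regular R R).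
Qed.

Lemma cube_compact : compact [set: cube R X].
Proof.
rewrite (_ : setT = [set f : cube R X | forall i, setT (f i)]); last first.
  by apply/seteqP; split.
apply: (@tychonoff _
  (fun _ : continuousType X (unit_interval R) => unit_interval R)
  (fun=> setT)) => _.
exact: unit_interval_compact.
Qed.

Lemma cube_coord_continuous (i : continuousType X (unit_interval R)) :
  continuous (fun f : cube R X => f i).
Proof.
exact: (@proj_continuous _
  (fun _ : continuousType X (unit_interval R) => unit_interval R) i).
Qed.

Lemma cube_tychonoff : tychonoff_space (cube R X).
Proof.
split.
  move=> f g fg.
  have [i fgi] : exists i, f i != g i.
    apply: contrapT => fgE; move/eqP: fg; apply.
    apply: functional_extensionality_dep.
    by move=> i; apply: contrapT => /eqP fgi; apply: fgE; exists i.
  have [U [Uopen fU gU]] := unit_interval_tychonoff.1 _ _ fgi.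
  exists ((fun h : cube R X => h i) @^-1` U); rewrite !inE in fU gU *; split=> //.
  exact: (continuousP _).1 (@cube_coord_continuous i) _ Uopen.
pose I : uniformType := set_type `[0 : R, 1]%classic.
exact: (@uniform_completely_regular R
  (prod_topology (fun _ : continuousType X (unit_interval R) => I))).
Qed.

Lemma stone_cech_tychonoff : tychonoff_space (stone_cech R X).
Proof. exact: (tychonoff_set_type R _ cube_tychonoff). Qed.

Lemma stone_cech_compact : compact [set: stone_cech R X].
Proof.
apply: compact_set_type; apply: subclosed_compact cube_compact _ => //.
exact: closed_closure.
Qed.


Lemma stone_cech_embed_continuous : continuous (@stone_cech_embed R X).
Proof.
have evalc : continuous (@cube_eval R X).
  by move=> x; apply/cvg_sup => f U [_ [[V Vopen <-] Vfx VU]];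
    apply: filterS VU _; apply: (@cts_fun _ _ f); exact: open_nbhs_nbhs.
move=> x U [_ [[V Vopen <-] Vx VU]].
by apply: filterS VU _; apply: evalc; exact: open_nbhs_nbhs.
Qed.

Lemma stone_cech_embed_dense : closure (range (@stone_cech_embed R X)) = setT.
Proof.
apply/seteqP; split=> // y _ U [_ [[V Vopen <-] Vy VU]].
have [_ [[x _ <-] Vx]] := set_valP y V (open_nbhs_nbhs (conj Vopen Vy)).
by exists (stone_cech_embed R x); split; [exists x|exact: VU].
Qed.

Lemma stone_cech_coord_continuous (f : continuousType X (unit_interval R)) :
  continuous (fun y : stone_cech R X => set_val y f).
Proof.
move=> y; apply: (@continuous_comp _ _ _ set_val (fun h : cube R X => h f)).
  exact: initial_continuous.
exact: cube_coord_continuous.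
Qed.

(** The indicator function of [W] is one of the coordinates of the cube; on the
    compactification this coordinate still takes only the values 0 and 1,
    since it does so on a dense set. *)
Lemma stone_cech_clopen (W : set X) : clopen W ->
  exists2 O : set (stone_cech R X), clopen O &
    forall x, O (stone_cech_embed R x) <-> W x.
Proof.
move=> [Wopen Wclosed].
have in0 : (0 : R) \in `[0 : R, 1]%classic by rewrite inE /= in_itv /= lexx ler01.
have in1 : (1 : R) \in `[0 : R, 1]%classic by rewrite inE /= in_itv /= lexx ler01.
pose u0 : unit_interval R := SigSub in0; pose u1 : unit_interval R := SigSub in1.
pose chi x := if x \in W then u1 else u0.
have chic : continuous chi.
  apply/continuousP => A _; rewrite (_ : _ @^-1` _ =
      (W `&` [set _ | A u1]) `|` (~` W `&` [set _ | A u0])); last first.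
    apply/seteqP; split=> x; rewrite /= /chi.
      by case: ifPn => [/set_mem|/negP xW]; [left|right; split=> // /mem_set].
    by case: ifPn => [/set_mem xW [[//]|[]//]|/negP xW [[/mem_set//]|[]//]].
  have cst_open (P : Prop) : open [set _ : X | P].
    have [p|np] := pselect P.
      by rewrite (_ : mkset _ = setT); [exact: openT|apply/seteqP; split].
    by rewrite (_ : mkset _ = set0); [exact: open0|apply/seteqP; split].
  by apply: openU; apply: openI => //; rewrite openC.
have u_closed (u : unit_interval R) : closed [set u].
  by apply: accessible_closed_set1; exact: unit_interval_tychonoff.1.
pose f : continuousType X (unit_interval R) := mkcts chic.
pose phi (y : stone_cech R X) := set_val y f.
have phic : continuous phi by exact: stone_cech_coord_continuous.
have phiE x : phi (stone_cech_embed R x) = chi x by [].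
have pre_closed u : closed (phi @^-1` [set u]).
  by move: (u_closed u); exact: (continuous_closedP phi).1.
have u10 : u1 <> u0 by move=> /(congr1 val)/eqP; rewrite /= oner_eq0.
have phi01 : phi @^-1` [set u1] = ~` (phi @^-1` [set u0]).
  apply/seteqP; split=> y; first by move=> /= -> .
  move=> y0; have : (phi @^-1` [set u1] `|` phi @^-1` [set u0]) y; last by case.
  move: y {y0}; apply: dense_sub_closed stone_cech_embed_dense _ _.
    exact: closedU.
  by move=> _ [x _ <-]; rewrite /= phiE /chi; case: ifP => _; [left|right].
exists (phi @^-1` [set u1]).
  by split; [rewrite phi01 openC|].
move=> x; rewrite /= phiE /chi; case: ifPn => [/set_mem//|/negP xW]; split.
  by move=> /esym.
by move=> /mem_set.
Qed.
End StoneCechFacts.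

(** * Adjoining one point of the compactification *)

Section AdjoinFacts.
Variables (R : realType) (X : topologicalType) (p : stone_cech R X).

Definition adjoin_embed (x : X) : adjoin p :=
  SigSub (mem_set (or_introl (imageT (@stone_cech_embed R X) x)
    : adjoin_set p (stone_cech_embed R x))).

Lemma adjoin_cases (y : adjoin p) :
  (exists x, y = adjoin_embed x) \/ y = adjoined_point p.
Proof.
have [[x _ xy]|yp] := set_valP y; [left; exists x|right]; apply: set_val_inj.
  exact: esym xy.
exact: yp.
Qed.

Lemma adjoin_embed_continuous : continuous adjoin_embed.
Proof.
move=> x U [_ [[V Vopen <-] Vx VU]].
by apply: filterS VU _; apply: stone_cech_embed_continuous; exact: open_nbhs_nbhs.
Qed.

Lemma adjoined_point_closure (S : set X) :
  closure (@stone_cech_embed R X @` S) p ->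
  closure (adjoin_embed @` S) (adjoined_point p).
Proof.
move=> Sp U [_ [[V Vopen <-] Vp VU]].
have [_ [[x Sx <-] Vx]] := Sp V (open_nbhs_nbhs (conj Vopen Vp)).
by exists (adjoin_embed x); split; [exists x|exact: VU].
Qed.

Lemma adjoin_embed_dense : closure (range adjoin_embed) = setT.
Proof.
apply/seteqP; split=> // y _; have [[x ->]|->] := adjoin_cases y.
  by apply: subset_closure; exists x.
by apply: adjoined_point_closure; rewrite stone_cech_embed_dense.
Qed.

Lemma adjoin_tychonoff : tychonoff_space (adjoin p).
Proof. exact: (tychonoff_set_type R _ (stone_cech_tychonoff R X)). Qed.

Lemma adjoin_clopen (W : set X) : clopen W ->
  exists2 O : set (adjoin p), clopen O & forall x, O (adjoin_embed x) <-> W x.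
Proof.
move=> /(stone_cech_clopen R)[U [Uopen Uclosed] UW].
have valc : continuous (set_val : adjoin p -> stone_cech R X).
  exact: initial_continuous.
exists (set_val @^-1` U) => //; split.
  by move: Uopen; exact: (continuousP set_val).1.
by move: Uclosed; exact: (continuous_closedP set_val).1.
Qed.

Hypothesis pNX : ~ range (@stone_cech_embed R X) p.

Lemma adjoin_embed_neq (x : X) : adjoin_embed x <> adjoined_point p.
Proof. by move=> /(congr1 set_val) xp; apply: pNX; exists x. Qed.

(** A clopen set of [X] is the trace of a clopen set of the extension, and the
    only other point that this set may contain is the closed point [p]. *)
Lemma adjoin_open_image (W : set X) : clopen W -> open (adjoin_embed @` W).
Proof.
move=> /adjoin_clopen[U [Uopen _] UW].
rewrite (_ : _ @` _ = U `&` ~` [set adjoined_point p]); last first.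
  apply/seteqP; split=> [_ [x Wx <-]|y [Uy yp]].
    by split; [exact/UW|exact: adjoin_embed_neq].
  by have [[x yx]|//] := adjoin_cases y; exists x => //; apply/UW; rewrite -yx.
apply: openI => //; rewrite openC; apply: accessible_closed_set1.
exact: adjoin_tychonoff.1.
Qed.

Lemma adjoin_image_embed (W : set X) (x : X) : clopen W ->
  (adjoin_embed @` W) (adjoin_embed x) -> W x.
Proof.
by move=> /adjoin_clopen[U _ UW] [y Wy yx]; apply/UW; rewrite -yx; apply/UW.
Qed.

End AdjoinFacts.

Section AdjoinPsi.
Variables (R : realType) (F : set (set nat)) (p : stone_cech R (Psi F)).

Lemma adjoin_Psi_pseudocompact :
  maximal_almost_disjoint F -> pseudocompact R (adjoin p).
Proof.
move=> Fmad; split=> [|f fc]; first exact: adjoin_tychonoff.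
have fec : continuous (f \o adjoin_embed p).
  by move=> x; apply: (@continuous_comp _ _ _ (adjoin_embed p) f);
    [exact: adjoin_embed_continuous|exact: fc].
have [K fK] := Psi_mad_bounded Fmad fec.
have Kclosed : closed [set t : R | `|t| <= K].
  exact: (continuous_closedP _).1 (@norm_continuous _ R) _ (@closed_le _ K).
have feK x : `|f (adjoin_embed p x)| <= K.
  move: x; apply: (@dense_sub_closed _ _ [set x | `|f (adjoin_embed p x)| <= K]).
  - by apply: Psi_nat_dense; exact: Fmad.1.1.
  - exact: (continuous_closedP _).1 fec _ Kclosed.
  - by move=> _ [n _ <-]; exact: fK.
have fyK y : `|f y| <= K.
  move: y; apply: (@dense_sub_closed _ _ [set y | `|f y| <= K]).
  - exact: adjoin_embed_dense.
  - exact: (continuous_closedP _).1 fc _ Kclosed.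
  - by move=> _ [x _ <-]; exact: feK.
exists K; split=> [|M KM y _]; first exact: num_real.
exact: le_trans (fyK y) (ltW KM).
Qed.

Hypothesis pNX : ~ range (@stone_cech_embed R (Psi F)) p.

(** Enlarge [D n] to the union of the [n]-th basic neighbourhoods of its points,
    or to the whole space while the new point belongs to [D n].  Nothing
    survives in the intersection: a member of the family lies in no basic
    neighbourhood but its own, and an integer [i] lies in no [n]-th
    neighbourhood of a member of the family once [i < n]. *)
Lemma adjoin_Psi_Delta : almost_disjoint F -> Delta_space (adjoin p).
Proof.
move=> Fad D Ddecr D0; pose e := adjoin_embed p.
have Dleft y : exists n, ~ D n y.
  apply: contrapT => allD; have : (\bigcap_n D n) y; last by rewrite D0.
  by move=> n _; apply: contrapT => nDy; apply: allD; exists n.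
have Dle m n y : (m <= n)%N -> D n y -> D m y.
  by move=> mn; exact: (subsetPset _ _ (Ddecr _ _ mn)).
pose V n := [set y : adjoin p | D n (adjoined_point p) \/
  exists2 x, D n (e x) & (e @` Psi_basic n x) y].
exists V; split.
- move=> n; have [Dp|nDp] := pselect (D n (adjoined_point p)).
    rewrite (_ : V n = setT); first exact: openT.
    by apply/seteqP; split=> // y _; left.
  rewrite (_ : V n = \bigcup_(x in [set x | D n (e x)]) (e @` Psi_basic n x)).
    by apply: bigcup_open => x _; apply: adjoin_open_image => //;
      exact: Psi_basic_clopen.
  by apply/seteqP; split=> [y [//|]|y]; [|right].
- move=> m n mn; apply/subsetPset => y [Dp|[x Dx [z zx <-]]].
    by left; exact: Dle mn Dp.
  right; exists x; first exact: Dle mn Dx.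
  exists z => //; case: x zx {Dx} => [k //|A [->|[i [Ai ni] <-]]]; first by left.
  by right; exists i => //; split=> //; exact: leq_trans mn ni.
- apply/seteqP; split=> // y Vy.
  have [m nDp] := Dleft (adjoined_point p); have [n nDy] := Dleft y.
  have Vm k : (m <= k)%N -> exists2 x, D k (e x) & (e @` Psi_basic k x) y.
    by move=> mk; have [/(Dle _ _ _ mk)|] := Vy k I.
  have [[x yx]|yp] := adjoin_cases y; last first.
    by have [x _ [z _]] := Vm m (leqnn m); rewrite yp; exact: adjoin_embed_neq.
  (* From stage [m] on [p] has left [D], from stage [n] on [y] has left [D], and
     an integer [i] is outside the neighbourhoods of stages beyond [i]. *)
  pose k := (match x with inl i => i.+1 | inr _ => 0 end + (m + n))%N.
  have mk : (m <= k)%N by rewrite /k addnCA leq_addr.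
  have nk : (n <= k)%N by rewrite /k addnA leq_addl.
  have [z Dz] := Vm k mk; rewrite yx => /adjoin_image_embed zx.
  have {}zx : Psi_basic k z x by apply: zx; exact: Psi_basic_clopen.
  suff zE : z = x by apply: nDy; apply: Dle nk _; rewrite yx -zE.
  case: x @k zx {yx mk nk Dz} => [i|A] k zx; last exact: Psi_basic_inr zx.
  case: z zx => [j /= [->//]|A [//|[j [_ kj] [ji]]]].
  by move: kj; rewrite /k ji ltnNge leq_addr.
- move=> n y Dy; have [[x yx]|yp] := adjoin_cases y; last by left; rewrite -yp.
  right; exists x; first by rewrite /e -yx.
  by exists x => //; case: (x) => // A; left.
Qed.

End AdjoinPsi.

(** * The limit point of a tower *)

Section TowerPoint.
Variables (R : realType) (C M : set (set nat)).
Hypotheses (Cdir : strict_directed C) (Mmad : maximal_almost_disjoint M).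
Hypothesis MC : M `<=` decides C.

(** The part of the family that the tower captures only after [T]. *)
Definition ladder (T : set nat) : set (Psi M) :=
  [set x | exists A : set_type M, [/\ x = inr A, ~ almost_sub (val A) T &
    exists2 T', C T' & almost_sub (val A) T']].

(** Some [T'] of the tower is strictly above [T].  A member of [M] meeting
    [T' `\` T] in an infinite set is not almost disjoint from [T'], so it is
    almost included in [T']. *)
Lemma ladder_nonempty (T : set nat) : C T -> ladder T !=set0.
Proof.
move=> CT; have [|_ ->//|T' CT' TT'] := @Cdir [set T].
  exact: finite_set_countable.
have [_ nT'T] := TT' T erefl.
have [A MA AT'T] := mad_meets Mmad nT'T.
exists (inr (SigSub (mem_set MA))); exists (SigSub (mem_set MA)); split=> //=.
  move=> AT; apply: AT'T; apply: sub_finite_set AT => n [An [_ nTn]].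
  by split.
exists T' => //; have [//|AT'] := MC MA CT'; case: AT'T.
by apply: sub_finite_set AT' => n [An []].
Qed.

Lemma ladder_anti (T T' : set nat) : almost_sub T T' -> ladder T' `<=` ladder T.
Proof.
move=> TT' x [A [-> AT' CA]]; exists A; split=> //.
by move=> AT; apply: AT'; exact: almost_sub_trans TT'.
Qed.

Lemma exists_ladder_point : exists p : stone_cech R (Psi M),
  forall T, C T -> closure (@stone_cech_embed R (Psi M) @` ladder T) p.
Proof.
pose B T := @stone_cech_embed R (Psi M) @` ladder T.
have FF : ProperFilter (filter_from C B).
  apply: filter_from_proper => [|T /ladder_nonempty[x Tx]]; last first.
    by exists (stone_cech_embed R x); exists x.
  apply: filter_from_filter.
    by have [//|//|T CT _] := @Cdir set0; exists T.
  move=> T T' CT CT'; have [||U CU TU] := @Cdir [set T; T'].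
  - exact/finite_set_countable/finite_set2.
  - by move=> _ [->|->].
  exists U => //; have [TU1 _] := TU T (or_introl erefl).
  have [TU2 _] := TU T' (or_intror erefl).
  by move=> _ [x Ux <-]; split; exists x => //; apply: ladder_anti Ux.
have [p [_ pB]] := @stone_cech_compact R (Psi M) _ FF filterT.
by exists p => T CT U; apply: pB; exists T.
Qed.

Variable p : stone_cech R (Psi M).
Hypothesis pladder : forall T, C T ->
  closure (@stone_cech_embed R (Psi M) @` ladder T) p.

Lemma ladder_point_open (O : set (stone_cech R (Psi M))) (T : set nat) :
  open O -> O p -> C T ->
  exists A : set_type M, [/\ O (@stone_cech_embed R (Psi M) (inr A)),
    ~ almost_sub (val A) T & exists2 T', C T' & almost_sub (val A) T'].
Proof.
move=> Oopen Op CT.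
have [_ [[x [A [-> AT CA]] <-] Ox]] :=
  pladder CT (open_nbhs_nbhs (conj Oopen Op)).
by exists A.
Qed.

(** A point of [Psi M] has a clopen neighbourhood with at most one member of
    the family, and no single member belongs to all the [ladder T]. *)
Lemma ladder_point_new : ~ range (@stone_cech_embed R (Psi M)) p.
Proof.
move=> [x _ xp].
have [U [Uopen _] UE] := stone_cech_clopen R (Psi_basic_clopen 0 x Mmad.1).
have Up : U p by rewrite -xp; apply/UE; case: (x) => // A; left.
have xinr T : C T -> exists A : set_type M, [/\ x = inr A,
    ~ almost_sub (val A) T & exists2 T', C T' & almost_sub (val A) T'].
  move=> CT; have [A [/UE/Psi_basic_inr -> ? ?]] := ladder_point_open Uopen Up CT.
  by exists A.
have [//|//|T CT _] := @Cdir set0.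
have [A [xA _ [T' CT' AT']]] := xinr T CT.
have [A' [xA' nAT' _]] := xinr T' CT'.
by apply: nAT'; move: xA'; rewrite xA => -[<-].
Qed.

(** The witness is [Z], the members of [M] captured by the tower.  A countable
    part of [Z] is captured by a single [T], hence lies in [Psi_under T]; the
    corresponding clopen set would contain [p], yet it misses [ladder T]. *)
Lemma ladder_point_not_tight : ~ countably_tight_at (adjoined_point p).
Proof.
pose Z : set (Psi M) := [set x | exists A : set_type M, x = inr A /\
  exists2 T, C T & almost_sub (val A) T].
have pZ : closure (adjoin_embed p @` Z) (adjoined_point p).
  have [//|//|T CT _] := @Cdir set0.
  apply: adjoined_point_closure; apply: closureS (pladder CT).
  by apply: image_subset => x [A [-> _ AT]]; exists A.
move=> /(_ _ pZ)[B [Bcount BZ pB]].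
have bound (y : adjoin p) : exists T, B y -> C T /\
    exists2 A : set_type M, y = adjoin_embed p (inr A : Psi M) &
      almost_sub (val A) T.
  have [By|nBy] := pselect (B y); last by exists set0.
  have [x [A [-> [T CT AT]]] <-] := BZ _ By.
  by exists T => _; split=> //; exists A.
have [t tP] := choice bound.
have [||T CT TB] := @Cdir (t @` B).
- exact: card_le_trans (card_image_le t B) Bcount.
- by move=> _ [y By <-]; have [] := tP y By.
have Tclopen : clopen (@Psi_under M T).
  by apply: Psi_under_clopen => A MA; exact: MC.
have [U [Uopen Uclosed] UE] := stone_cech_clopen R Tclopen.
have Up : U p.
  have U'closed : closed (set_val @^-1` U : set (adjoin p)).
    move: Uclosed; apply: (continuous_closedP set_val).1.
    exact: initial_continuous.
  apply: (U'closed (adjoined_point p)); apply: closureS pB => y By.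
  have [_ [A yA At]] := tP y By; rewrite yA; apply/UE => /=.
  by apply: almost_sub_trans At _; have [] := TB (t y) (ex_intro2 _ _ y By erefl).
by have [A [/UE AT nAT _]] := ladder_point_open Uopen Up CT; apply: nAT.
Qed.

End TowerPoint.

Theorem theorem4p10 (R : realType) :
  exists M : set (set nat), maximal_almost_disjoint M /\
  exists p : stone_cech R (Psi M),
    [/\ ~ range (@stone_cech_embed R (Psi M)) p,
        pseudocompact R (adjoin p),
        Delta_space (adjoin p) &
        ~ countably_tight_at (adjoined_point p)].
Proof.
have [C Ctower Cmax] := exists_maximal_tower.
have Cdir := maximal_tower_directed Ctower Cmax.
have [M Mmad MC] := exists_mad_in (fun B => tower_decided_subset Ctower (B := B)).
have [p pladder] := exists_ladder_point R Cdir Mmad MC.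
have pNX := ladder_point_new Cdir Mmad pladder.
exists M; split=> //; exists p; split=> //.
- exact: adjoin_Psi_pseudocompact.
- exact: adjoin_Psi_Delta Mmad.1.
- exact: (ladder_point_not_tight Cdir MC pladder).
Qed.
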